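(* The class of chain graphs is generalized spectrally closed. That is, if $G$ is a chain graph (equivalently, $G$ contains no induced subgraph isomorphic to $2K_2$, $C_3$ or $C_5$) and $H$ is a graph that is generalized cospectral with $G$, then $H$ is also a chain graph.
   Context: All graphs are finite, simple and undirected. $A(G)$ denotes the adjacency matrix of $G$ and $\overline{G}$ its complement. The spectrum of $G$ is the multiset of eigenvalues of $A(G)$; the generalized spectrum of $G$ is the spectrum of $G$ together with the spectrum of $\overline{G}$. Two graphs $G$ and $H$ are generalized cospectral if they have the same generalized spectrum, i.e. $G,H$ have the same spectrum and $\overline{G},\overline{H}$ have the same spectrum. A graph class $\mathcal{C}$ is generalized spectrally closed if no graph in $\mathcal{C}$ is generalized cospectral with a graph outside $\mathcal{C}$. For a family $\mathcal{F}$ of graphs, $\operatorname{Forb}(\mathcal{F})$ is the class of graphs containing no induced subgraph isomorphic to a member of $\mathcal{F}$. The class of chain graphs is $\operatorname{Forb}(2K_2,C_3,C_5)$, where $2K_2$ is the disjoint union of two edges, and $C_m$ is the cycle on $m$ vertices. *)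

(* Defs.v *)
From HB Require Import structures.
From mathcomp Require Import all_boot all_order all_algebra all_field.

Set Implicit Arguments.
Unset Strict Implicit.
Unset Printing Implicit Defensive.

Import GRing.Theory.
Local Open Scope ring_scope.

Record sgraph := SGraph {
  vertex :> finType;
  adj : rel vertex;
  adj_sym : symmetric adj;
  adj_irrefl : irreflexive adj
}.

Section Constructions.

Variables G H : sgraph.

Definition compl_adj : rel G := fun x y => (x != y) && ~~ adj x y.

Fact compl_adj_sym : symmetric compl_adj.
Proof. by move=> x y; rewrite /compl_adj eq_sym adj_sym. Qed.

Fact compl_adj_irrefl : irreflexive compl_adj.
Proof. by move=> x; rewrite /compl_adj eqxx. Qed.

Definition compl_graph : sgraph := SGraph compl_adj_sym compl_adj_irrefl.

Variable S : {set G}.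

Definition induced_adj : rel {x : G | x \in S} :=
  fun x y => adj (val x) (val y).

Fact induced_adj_sym : symmetric induced_adj.
Proof. by move=> x y; rewrite /induced_adj adj_sym. Qed.

Fact induced_adj_irrefl : irreflexive induced_adj.
Proof. by move=> x; rewrite /induced_adj adj_irrefl. Qed.

Definition induced_subgraph : sgraph :=
  SGraph induced_adj_sym induced_adj_irrefl.

Definition dunion_adj : rel (G + H)%type := fun u v =>
  match u, v with
  | inl x, inl y => adj x y
  | inr x, inr y => adj x y
  | _, _ => false
  end.

Fact dunion_adj_sym : symmetric dunion_adj.
Proof. by move=> [x|x] [y|y] //=; rewrite adj_sym. Qed.

Fact dunion_adj_irrefl : irreflexive dunion_adj.
Proof. by move=> [x|x] /=; rewrite adj_irrefl. Qed.

Definition dunion_graph : sgraph := SGraph dunion_adj_sym dunion_adj_irrefl.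

End Constructions.

Definition complete_adj (n : nat) : rel 'I_n := fun i j => i != j.

Fact complete_adj_sym n : symmetric (@complete_adj n).
Proof. by move=> i j; rewrite /complete_adj eq_sym. Qed.

Fact complete_adj_irrefl n : irreflexive (@complete_adj n).
Proof. by move=> i; rewrite /complete_adj eqxx. Qed.

Definition complete_graph (n : nat) : sgraph :=
  SGraph (@complete_adj_sym n) (@complete_adj_irrefl n).

(* [ordS] is the cyclic successor of 'I_n; this is the n-cycle for n >= 3 (the
   condition i != j only matters for the degenerate case n = 1). *)
Definition cycle_adj (n : nat) : rel 'I_n :=
  fun i j => (i != j) && ((ordS i == j) || (ordS j == i)).

Fact cycle_adj_sym n : symmetric (@cycle_adj n).
Proof. by move=> i j; rewrite /cycle_adj eq_sym orbC. Qed.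

Fact cycle_adj_irrefl n : irreflexive (@cycle_adj n).
Proof. by move=> i; rewrite /cycle_adj eqxx. Qed.

Definition cycle_graph (n : nat) : sgraph :=
  SGraph (@cycle_adj_sym n) (@cycle_adj_irrefl n).

Definition two_K2 : sgraph :=
  dunion_graph (complete_graph 2) (complete_graph 2).

Definition isomorphic (G H : sgraph) : Prop :=
  exists2 f : G -> H, bijective f & forall x y, adj (f x) (f y) = adj x y.

Definition Forb (F : sgraph -> Prop) (G : sgraph) : Prop :=
  forall F0 : sgraph, F F0 ->
  ~ exists S : {set G}, isomorphic (induced_subgraph S) F0.

Definition chain_graph : sgraph -> Prop :=
  Forb (fun F => [\/ F = two_K2, F = cycle_graph 3 | F = cycle_graph 5]).

(* Vertices are numbered by [enum_val]; the spectrum does not depend on this. *)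
Definition adjacency_matrix (G : sgraph) : 'M[algC]_#|G| :=
  \matrix_(i, j) (adj (enum_val i) (enum_val j))%:R.

(* The roots of the characteristic polynomial, repeated with multiplicity, in
   an arbitrary order: spectra are to be compared with [perm_eq]. *)
Definition spectrum (G : sgraph) : seq algC :=
  sval (closed_field_poly_normal (char_poly (adjacency_matrix G))).

Fact spectrumE (G : sgraph) :
  char_poly (adjacency_matrix G) = \prod_(a <- spectrum G) ('X - a%:P).
Proof.
rewrite /spectrum; case: closed_field_poly_normal => r /= {1}->.
by rewrite (monicP (char_poly_monic _)) scale1r.
Qed.

Definition cospectral (G H : sgraph) : Prop :=
  perm_eq (spectrum G) (spectrum H).

Definition generalized_cospectral (G H : sgraph) : Prop :=
  cospectral G H /\ cospectral (compl_graph G) (compl_graph H).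

Definition generalized_spectrally_closed (C : sgraph -> Prop) : Prop :=
  forall G H : sgraph, C G -> generalized_cospectral G H -> C H.

(* Main.v *)
Require Import Defs.
From mathcomp Require Import all_boot all_order all_algebra all_field.
From mathcomp Require Import ring.

(* A graph has no C_3 iff tr A^3 = 0, and a triangle-free graph has no C_5 iff
   tr A^5 = 0.  In a triangle-free graph, two disjoint edges that do not induce
   2K_2 are joined by one edge or by a perfect matching, so the number of
   (ordered) induced copies of 2K_2 is w_1^2 - 4 w_3 + 2 tr A^4, where w_k is the
   sum of the entries of A^k.  Finally w_1, w_2, w_3 are read off from the traces
   of the powers of J - A, the adjacency matrix of the complement plus the
   identity. *)

Set Implicit Arguments.
Unset Strict Implicit.
Unset Printing Implicit Defensive.

Import Order.TTheory GRing.Theory Num.Theory.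
Local Open Scope ring_scope.

(** * Entry sums, and traces of powers of [J - A] with [J] the all-ones matrix *)

Section EntrySum.

Variable R : comPzRingType.

Definition entry_sum m n (M : 'M[R]_(m, n)) : R := \sum_i \sum_j M i j.

Lemma entry_sum_mx11 m n (M : 'M[R]_(m, n)) :
  const_mx 1 *m M *m const_mx 1 = (entry_sum M)%:M :> 'M_1.
Proof.
apply/matrixP=> i j; rewrite !ord1 !mxE eqxx mulr1n /entry_sum exchange_big.
apply: eq_bigr => k _; rewrite !mxE mulr1.
by apply: eq_bigr => l _; rewrite mxE mul1r.
Qed.

(** Since [J] is a column of ones times a row of ones, the middle of [J *m M *m J] collapses to a
    scalar. *)
Lemma mul_allones n (M : 'M[R]_n) :
  (const_mx 1 : 'M_n) *m M *m (const_mx 1 : 'M_n) = entry_sum M *: const_mx 1.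
Proof.
have J : const_mx 1 = (const_mx 1 : 'cV[R]_n) *m (const_mx 1 : 'rV_n).
  by apply/matrixP=> i j; rewrite !mxE big_ord1 !mxE mulr1.
by rewrite J !mulmxA -!(mulmxA (const_mx 1 : 'cV[R]_n)) entry_sum_mx11
  mul_scalar_mx -scalemxAr.
Qed.

Lemma entry_sum1 n : entry_sum (1 : 'M[R]_n) = n%:R.
Proof.
rewrite /entry_sum -[RHS]mxtrace1; apply: eq_bigr => i _.
rewrite (bigD1 i) //= big1 ?addr0 // => j; rewrite mxE eq_sym.
by move/negPf->.
Qed.

Lemma mxtrace_mul_allones n (M : 'M[R]_n) :
  \tr ((const_mx 1 : 'M_n) *m M) = entry_sum M.
Proof.
rewrite /entry_sum exchange_big /mxtrace; apply: eq_bigr => i _.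
by rewrite mxE; apply: eq_bigr => j _; rewrite mxE mul1r.
Qed.

Lemma entry_sum_mul_allones n (M N : 'M[R]_n) :
  entry_sum (M *m (const_mx 1 : 'M_n) *m N) = entry_sum M * entry_sum N.
Proof.
rewrite -mxtrace_mul_allones !mulmxA mul_allones -scalemxAl mxtraceZ.
by rewrite mxtrace_mul_allones.
Qed.

Section AllOnesMinus.

Variables (n : nat) (A : 'M[R]_n).
Local Notation J := (const_mx 1 : 'M[R]_n).
Local Notation w k := (entry_sum (A ^+ k)).

(** The rules below evaluate every right-nested word in [J] and [A] that arises: cyclicity of the
    trace uses up one [J], and each further [J] splits an entry sum into a product. *)
Let trJX X : \tr (J * X) = entry_sum X.
Proof. exact: mxtrace_mul_allones. Qed.

Let trXJ X : \tr (X * J) = entry_sum X.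
Proof. by rewrite -mulmxE mxtrace_mulC mxtrace_mul_allones. Qed.

Let trXJY X Y : \tr (X * (J * Y)) = entry_sum (Y * X).
Proof. by rewrite -mulmxE mxtrace_mulC -mulmxA mxtrace_mul_allones. Qed.

Let trXXJ X Y : \tr (X * (Y * J)) = entry_sum (X * Y).
Proof. by rewrite mulrA trXJ. Qed.

Let trXXJY X Y Z : \tr (X * (Y * (J * Z))) = entry_sum (Z * (X * Y)).
Proof. by rewrite [X * _]mulrA trXJY. Qed.

Let trXXXJ X Y Z : \tr (X * (Y * (Z * J))) = entry_sum (X * (Y * Z)).
Proof. by rewrite !mulrA trXJ. Qed.

Let wXJY X Y : entry_sum (X * (J * Y)) = entry_sum X * entry_sum Y.
Proof. by rewrite -mulmxE mulmxA entry_sum_mul_allones. Qed.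

Let wJX X : entry_sum (J * X) = n%:R * entry_sum X.
Proof. by rewrite -[X in entry_sum X]mul1r wXJY entry_sum1. Qed.

Let wXJ X : entry_sum (X * J) = n%:R * entry_sum X.
Proof. by rewrite -[J]mulr1 wXJY entry_sum1 mulrC. Qed.

Let wXXJ X Y : entry_sum (X * (Y * J)) = n%:R * entry_sum (X * Y).
Proof. by rewrite mulrA wXJ. Qed.

Let wJ : entry_sum J = n%:R ^+ 2.
Proof. by rewrite -[J]mulr1 wJX entry_sum1. Qed.

Lemma mxtrace_allonesB2 :
  \tr ((J - A) ^+ 2) = n%:R ^+ 2 - 2%:R * w 1 + \tr (A ^+ 2).
Proof.
rewrite !expr2 expr1 mulrBl !mulrBr !raddfB /= !(trJX, trXJ) wJ.
by ring.
Qed.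

Lemma mxtrace_allonesB3 :
  \tr ((J - A) ^+ 3) =
    n%:R ^+ 3 - 3%:R * n%:R * w 1 + 3%:R * w 2 - \tr (A ^+ 3).
Proof.
rewrite !exprS !expr0 !mulr1 !(mulrBl, mulrBr) !raddfB /= -!mulrA.
rewrite !(trJX, trXJ, trXXJ, trXJY, wXJY, wJX, wXJ, wJ).
by ring.
Qed.

(** Among the words with two [J] and two [A], the four rotations of [JJAA] give [n * w 2] each, and
    the two alternating ones give [w 1 ^+ 2] each. *)
Lemma mxtrace_allonesB4 :
  \tr ((J - A) ^+ 4) =
    n%:R ^+ 4 - 4%:R * n%:R ^+ 2 * w 1 + 4%:R * n%:R * w 2 + 2%:R * w 1 ^+ 2
    - 4%:R * w 3 + \tr (A ^+ 4).
Proof.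
rewrite !exprS !expr0 !mulr1 !(mulrBl, mulrBr) !raddfB /= -!mulrA.
rewrite !(trJX, trXJ, trXXXJ, trXXJY, trXXJ, trXJY) -?mulrA.
rewrite !(wXXJ, wXJY, wJX, wXJ, wJ).
by ring.
Qed.

End AllOnesMinus.

End EntrySum.

(** * Traces of powers as power sums of eigenvalues *)

Lemma mxtrace_exp_roots n (A : 'M[algC]_n) (s : seq algC) (k : nat) :
  A \is normalmx -> char_poly A = \prod_(a <- s) ('X - a%:P) ->
  \tr (A ^+ k) = \sum_(a <- s) a ^+ k.
Proof.
move=> /orthomx_spectralP; set P := spectralmx A; set d := spectral_diag A.
have Pu : P \in unitmx := spectral_unit A.
move=> defA charA.
have -> : \tr (A ^+ k) = \sum_i d 0 i ^+ k.
  have -> : A ^+ k = invmx P *m diag_mx (\row_i d 0 i ^+ k) *m P.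
    elim: k => [|k IHk].
      have -> : \row_i d 0 i ^+ 0 = const_mx 1 by apply/rowP=> i; rewrite !mxE.
      by rewrite diag_const_mx mulmx1 mulVmx.
    rewrite exprS IHk [A in A * _]defA -mulmxE !mulmxA mulmxK //.
    congr (_ *m _); rewrite -!mulmxA mulmx_diag; congr (_ *m diag_mx _).
    by apply/rowP=> i; rewrite !mxE exprS.
  rewrite mxtrace_mulC mulmxA mulmxV // mul1mx mxtrace_diag.
  by apply: eq_bigr => i _; rewrite mxE.
(* A split monic polynomial determines its roots up to order, so [s] may be replaced by the diagonal
   entries once both have the same product. *)
suff /prod_XsubC_eq/(perm_big _)-> :
    \prod_(a <- s) ('X - a%:P) = \prod_(a <- [seq d 0 i | i : 'I_n]) ('X - a%:P).
  by rewrite big_image.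
rewrite -charA big_image /=.
transitivity (char_poly (diag_mx d)); last first.
  rewrite char_poly_trig ?diag_mx_is_trig //.
  by apply: eq_bigr => i _; rewrite mxE eqxx mulr1n.
rewrite /char_poly /char_poly_mx defA !map_mxM /= map_invmx /=.
set Q := map_mx _ P; have Qu : Q \in unitmx.
  by rewrite unitmxE det_map_mx rmorph_unit // -unitmxE.
set D := map_mx _ _.
have -> : 'X%:M - invmx Q *m D *m Q = invmx Q *m ('X%:M - D) *m Q.
  by rewrite mulmxBr mulmxBl mul_mx_scalar -scalemxAl mulVmx // scalemx1.
by rewrite !det_mulmx mulrAC det_inv mulVr ?mul1r.
Qed.

(** * Powers of the adjacency matrix and walks *)

Section AdjacencyMatrix.

Variable G : sgraph.
Local Notation A := (adjacency_matrix G).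

Lemma adjacency_matrix_normal : A \is normalmx.
Proof.
apply/normalmxP; suff -> : (A ^t* )%sesqui = A by [].
by apply/matrixP=> i j; rewrite !mxE adj_sym conjC_nat.
Qed.

Lemma mxtrace_adjacency_exp k :
  \tr (A ^+ k) = \sum_(a <- spectrum G) a ^+ k.
Proof. exact: mxtrace_exp_roots adjacency_matrix_normal (spectrumE G). Qed.

Lemma adjacency_matrix_compl :
  adjacency_matrix (compl_graph G) + 1 = const_mx 1 - A :> 'M_#|G|.
Proof.
apply/matrixP=> i j; rewrite !mxE /= /compl_adj (inj_eq enum_val_inj).
by have [->|_] := eqVneq i j; rewrite ?adj_irrefl /= ?add0r ?subr0 //;
  case: adj; rewrite /= ?addr0 ?subrr ?subr0.
Qed.

Lemma adjacency_exp_ge0 k i j : 0 <= (A ^+ k) i j.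
Proof.
elim: k i j => [|k IHk] i j; first by rewrite expr0 mxE ler0n.
by rewrite exprS mxE sumr_ge0 // => l _; rewrite mulr_ge0 // mxE ler0n.
Qed.

(** All terms are nonnegative, so nothing cancels: an entry of [A * A ^+ k] is nonzero exactly when
    some intermediate vertex contributes. *)
Lemma adjacency_exp_neq0 k x y :
  (A ^+ k) (enum_rank x) (enum_rank y) != 0 <->
  exists p : seq G, [/\ size p = k, path (@adj G) x p & last x p = y].
Proof.
elim: k x y => [|k IHk] x y.
  rewrite expr0 mxE pnatr_eq0 eqb0 negbK (inj_eq enum_rank_inj).
  by split=> [/eqP-> | [p []]]; [exists [::] | move/size0nil=> -> _ /= ->].
rewrite exprS mxE psumr_eq0 => [|l _]; last first.
  by rewrite mulr_ge0 ?adjacency_exp_ge0 // mxE ler0n.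
split=> [/allPn[l _ /=]|[[|z p] [] // [szp] /andP[xz pzp] lzp]].
  rewrite -[l]enum_valK mulf_eq0 negb_or mxE !enum_rankK pnatr_eq0 eqb0 negbK.
  move=> /andP[xl /IHk[p [szp pp lp]]]; exists (enum_val l :: p).
  by rewrite /= szp xl.
apply/allPn; exists (enum_rank z); first by rewrite mem_index_enum.
rewrite /= mulf_neq0 //; first by rewrite mxE !enum_rankK xz oner_eq0.
by apply/IHk; exists p.
Qed.

(** A diagonal entry is nonzero exactly when a closed walk starts at that vertex. The exponent is a
    successor because [cycle] holds of the empty sequence. *)
Lemma mxtrace_adjacency_exp_eq0 k :
  \tr (A ^+ k.+1) = 0 <->
  forall p : seq G, size p = k.+1 -> ~~ cycle (@adj G) p.
Proof.
split=> [tr0 [|x p] //= [szp]|nocycle].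
  have /(_ (enum_rank x) isT) := psumr_eq0P
    (fun i _ => adjacency_exp_ge0 k.+1 i i) tr0.
  apply: contra_eqN => xpx; apply/adjacency_exp_neq0.
  by exists (rcons p x); rewrite size_rcons szp last_rcons.
apply: big1 => i _; apply/eqP; rewrite -[i]enum_valK; apply/negPn/negP.
move=> /adjacency_exp_neq0[p [szp + lp]].
case/lastP: p szp lp => // p y; rewrite size_rcons last_rcons => szp ->.
by apply/negP; apply: (nocycle (_ :: p)); rewrite /= -szp.
Qed.

End AdjacencyMatrix.

(* Expanding the product, every monomial other than those on the right
   contains a triangle. *)
Lemma sum_induced_2K2 (R : comPzRingType) n (A : 'M[R]_n) :
    (forall i j, A i j = A j i) ->
    (forall i j k, A i j * A i k * A j k = 0) ->
  \sum_i \sum_j \sum_k \sum_l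
     A i j * A k l * ((1 - A i k) * (1 - A i l) * (1 - A j k) * (1 - A j l)) =
  entry_sum (A ^+ 1) ^+ 2 - 4%:R * entry_sum (A ^+ 3) + 2%:R * \tr (A ^+ 4).
Proof.
move=> symA triA.
pose S F : R := \sum_(i < n) \sum_(j < n) \sum_(k < n) \sum_(l < n) F i j k l.
have SC12 F : S F = S (fun i j k l => F j i k l) by exact: exchange_big.
have SC34 F : S F = S (fun i j k l => F i j l k).
  by do 2!(apply: eq_bigr => ? _); exact: exchange_big.
have eqS F F' : (forall i j k l, F i j k l = F' i j k l) -> S F = S F'.
  by move=> eqF; do 4!(apply: eq_bigr => ? _).
have SD F F' : S (fun i j k l => F i j k l + F' i j k l) = S F + S F'.
  rewrite /S -big_split; apply: eq_bigr => i _.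
  rewrite -big_split; apply: eq_bigr => j _.
  by rewrite -big_split; apply: eq_bigr => k _; rewrite -big_split.
have SN F : S (fun i j k l => - F i j k l) = - S F.
  by rewrite /S -sumrN; do 3!(apply: eq_bigr => ? _; rewrite -sumrN).
rewrite -/(S _).
have S1 : S (fun i j k l => A i j * A k l) = entry_sum (A ^+ 1) ^+ 2.
  rewrite expr1 expr2 /entry_sum big_distrlr /=.
  rewrite /S; apply: eq_bigr => i _; rewrite exchange_big; apply: eq_bigr => k _.
  by rewrite big_distrlr.
(* The three edges form the walk j, i, k, l; the other single joining edges reduce to this one by
   swapping the ends of an edge. *)
have S3 : S (fun i j k l => A i j * A k l * A i k) = entry_sum (A ^+ 3).
  rewrite SC12 /entry_sum !exprS expr0 mulr1 -!mulmxE mulmxA.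
  apply: eq_bigr => u _; rewrite exchange_big /=.
  under eq_bigr do rewrite exchange_big /=.
  rewrite exchange_big; apply: eq_bigr => v _.
  rewrite mxE; apply: eq_bigr => t _; rewrite mxE mulr_suml.
  by apply: eq_bigr => s _; rewrite (symA s u) mulrAC.
(* The four edges form the closed walk i, j, l, k. *)
have S4 : S (fun i j k l => A i j * A k l * (A i k * A j l)) = \tr (A ^+ 4).
  rewrite !exprS expr0 mulr1 -!mulmxE !mulmxA.
  apply: eq_bigr => i _; rewrite exchange_big mxE; apply: eq_bigr => k _.
  rewrite exchange_big mxE mulr_suml; apply: eq_bigr => l _.
  rewrite mxE !mulr_suml; apply: eq_bigr => j _.
  by rewrite (symA k l) (symA i k); ring.
have S3jk : S (fun i j k l => A i j * A k l * A j k) = entry_sum (A ^+ 3).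
  by rewrite -S3 SC12; apply: eqS => i j k l; rewrite (symA j i).
have S3il : S (fun i j k l => A i j * A k l * A i l) = entry_sum (A ^+ 3).
  by rewrite -S3 SC34; apply: eqS => i j k l; rewrite (symA l k).
have S3jl : S (fun i j k l => A i j * A k l * A j l) = entry_sum (A ^+ 3).
  by rewrite -S3jk SC34; apply: eqS => i j k l; rewrite (symA l k).
have S4' : S (fun i j k l => A i j * A k l * (A i l * A j k)) = \tr (A ^+ 4).
  by rewrite -S4 SC34; apply: eqS => i j k l; rewrite (symA l k).
pose t i j k l := A i j * A k l.
transitivity (S (fun i j k l => t i j k l + - (t i j k l * A i k)
    + - (t i j k l * A i l) + - (t i j k l * A j k) + - (t i j k l * A j l)
    + t i j k l * (A i k * A j l) + t i j k l * (A i l * A j k))).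
  apply: eqS => i j k l; rewrite /t.
  set x := A i j; set y := A k l; set p := A i k; set q := A i l.
  set r := A j k; set s := A j l.
  have xpr : x * p * r = 0 by apply: triA.
  have xqs : x * q * s = 0 by apply: triA.
  have ypq : y * p * q = 0 by rewrite -mulrA mulrC; exact: triA.
  have yrs : y * r * s = 0 by rewrite -mulrA mulrC; exact: triA.
  (* The remaining monomials are grouped by a triangle product dividing them: [y * p * q],
     [x * p * r], [x * q * s] or [y * r * s]. *)
  transitivity (x * y + - (x * y * p) + - (x * y * q) + - (x * y * r)
    + - (x * y * s) + x * y * (p * s) + x * y * (q * r)
    + y * p * q * (x - x * r - x * s + x * r * s)
    + x * p * r * (y - y * s) + x * q * s * (y - y * r)
    + y * r * s * x); first by ring.
  by rewrite xpr xqs ypq yrs !mul0r !addr0.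
rewrite !SD !SN S1 S3 S3il S3jk S3jl S4 S4'.
by ring.
Qed.

(** * Forbidden induced subgraphs as conditions on vertices and walks *)

Lemma induced_subgraph_iso (G F : sgraph) :
  (exists S : {set G}, isomorphic (induced_subgraph S) F) <->
  exists2 f : F -> G, injective f & forall x y, adj (f x) (f y) = adj x y.
Proof.
split=> [[S [g [g' gK g'K] adjg]]|[f injf adjf]].
  exists (fun x => val (g' x)) => [x y /val_inj/(can_inj g'K)//|x y].
  by rewrite -{2}[x]g'K -{2}[y]g'K adjg.
pose h (x : F) : induced_subgraph (f @: setT) :=
  exist _ (f x) (imset_f f (in_setT x)).
(* [h] is [f] with its codomain cut down to the image, hence bijective by counting. *)
have [h' hK h'K] : bijective h.
  apply: inj_card_bij => [x y [/injf]//|].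
  by rewrite card_sig card_imset // cardsT.
exists (f @: setT), h'; first by exists h.
by move=> x y; rewrite -adjf -{2}[x]h'K -{2}[y]h'K.
Qed.

Lemma triangle_uniq (G : sgraph) (p : seq G) :
  size p = 3 -> cycle (@adj G) p -> uniq p.
Proof.
case: p => [|a [|b [|c []]]] //= _ /and4P[ab bc ca _].
rewrite !inE negb_or !andbT -andbA.
by apply/and3P; split; apply/eqP=> E; subst; rewrite adj_irrefl in ab bc ca.
Qed.

Section ChainGraph.

Variable G : sgraph.

(** Stated, like [no_closed_5walk], through closed walks that may repeat vertices, to match the
    vanishing of the trace of a power. *)
Definition triangle_free :=
  forall p : seq G, size p = 3 -> ~~ cycle (@adj G) p.

Definition no_closed_5walk :=
  forall p : seq G, size p = 5 -> ~~ cycle (@adj G) p.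

(* The conditions force a, b, c, d to be distinct: a = c would give adj a d. *)
Definition two_K2_free := forall a b c d : G,
  ~~ [&& adj a b, adj c d, ~~ adj a c, ~~ adj a d, ~~ adj b c & ~~ adj b d].

Lemma Forb_C3 :
  ~ (exists S : {set G}, isomorphic (induced_subgraph S) (cycle_graph 3)) <->
  triangle_free.
Proof.
split=> [noC3 p szp|tf /induced_subgraph_iso[f _ adjf]]; last first.
  have /negP[] := tf [:: f (inord 0); f (inord 1); f (inord 2)] erefl.
  by rewrite /= !adjf /= /cycle_adj -!val_eqE /= !inordK.
apply/negP=> cp; apply: noC3; apply/induced_subgraph_iso.
have up := triangle_uniq szp cp.
case: p szp cp up => [|a [|b [|c []]]] //= _ /and4P[ab bc ca _] up.
exists (fun i : 'I_3 => nth a [:: a; b; c] i) => [i j /eqP|].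
  by rewrite nth_uniq // => /eqP/val_inj.
by move=> [[|[|[|]]] //= ?] [[|[|[|]]] //= ?];
  rewrite /cycle_adj -!val_eqE /= ?adj_irrefl // adj_sym.
Qed.

(* In a triangle-free graph, a closed walk of length 5 has no repeated vertex
   and no chord, since either would close up a triangle. *)
Lemma Forb_C5 : triangle_free ->
  ~ (exists S : {set G}, isomorphic (induced_subgraph S) (cycle_graph 5)) <->
  no_closed_5walk.
Proof.
move=> tf.
split=> [noC5 p szp|tf5 /induced_subgraph_iso[f _ adjf]]; last first.
  have /negP[] := tf5 [seq f (inord i) | i <- iota 0 5] erefl.
  by rewrite /= !adjf /= /cycle_adj -!val_eqE /= !inordK.
apply/negP=> cp; apply: noC5; apply/induced_subgraph_iso.
case: p szp cp => [|a [|b [|c [|d [|e []]]]]] //= _ /and5P[ab bc cd de /andP[ea _]].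
have tri (x y z : G) : adj x y -> adj y z -> adj z x = false.
  by move=> xy yz; have := tf [:: x; y; z] erefl; rewrite /= xy yz andbT => /negbTE.
have neq (x y : G) : adj x y -> x != y by apply: contraTneq => ->; rewrite adj_irrefl.
have ca := tri _ _ _ ab bc; have db := tri _ _ _ bc cd.
have ec := tri _ _ _ cd de; have ad := tri _ _ _ de ea.
have be := tri _ _ _ ea ab.
(* Identifying two nonconsecutive vertices would turn an edge of the walk into one of the five
   excluded chords. *)
have up : uniq [:: a; b; c; d; e].
  have ac : a != c by apply: contraFneq ad => ->.
  have da : a != d by apply: contraFneq ca => ->.
  have bd : b != d by apply: contraFneq be => ->.
  have eb : b != e by apply: contraFneq db => ->.
  have ce : c != e by apply: contraFneq ca => ->.
  by rewrite /= !inE !negb_or ac da bd eb ce [a == e]eq_sym !neq.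
exists (fun i : 'I_5 => nth a [:: a; b; c; d; e] i) => [i j /eqP|].
  by rewrite nth_uniq // => /eqP/val_inj.
by move=> [[|[|[|[|[|]]]]] //= ?] [[|[|[|[|[|]]]]] //= ?];
  rewrite /cycle_adj -!val_eqE /= ?adj_irrefl //; rewrite // adj_sym.
Qed.

Lemma Forb_two_K2 :
  ~ (exists S : {set G}, isomorphic (induced_subgraph S) two_K2) <->
  two_K2_free.
Proof.
split=> [no2K2 a b c d|free /induced_subgraph_iso[f _ adjf]]; last first.
  have /negP[] := free (f (inl ord0)) (f (inl ord_max))
    (f (inr ord0)) (f (inr ord_max)).
  by rewrite !adjf.
apply/negP=> /and5P[ab cd ac ad /andP[bc bd]].
apply: no2K2; apply/induced_subgraph_iso.
pose f (u : 'I_2 + 'I_2) := match u with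
  | inl i => nth a [:: a; b] i | inr i => nth a [:: c; d] i end.
have adjf u v : adj (f u) (f v) = @adj two_K2 u v.
  move: u v => [[[|[|]] //= ?]|[[|[|]] //= ?]] [[[|[|]] //= ?]|[[|[|]] //= ?]];
    rewrite /complete_adj -?val_eqE /= ?adj_irrefl //;
    by [| apply: negbTE | apply: negbTE; rewrite adj_sym | rewrite adj_sym].
exists f => // u v fuv.
(* Injectivity follows from adjacency alone: distinct vertices on one side are adjacent, so merging
   them would give a loop; vertices on opposite sides are separated by the neighbour [rev_ord i]. *)
have nei (i : 'I_2) : complete_adj i (rev_ord i) by case: i => [[|[|]]].
have irr := adj_irrefl (f u).
case: u v fuv irr => [i|i] [j|j] fuv.
- by rewrite {2}fuv adjf => /eqP->.
- by move: (adjf (inl i) (inl (rev_ord i))); rewrite fuv adjf /= nei.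
- by move: (adjf (inr i) (inr (rev_ord i))); rewrite fuv adjf /= nei.
- by rewrite {2}fuv adjf => /eqP->.
Qed.

Lemma chain_graphP :
  chain_graph G <-> [/\ triangle_free, no_closed_5walk & two_K2_free].
Proof.
split=> [chG|[tf /(Forb_C5 tf) noC5 /Forb_two_K2 no2K2] F [|->|->]]; last 3 first.
- by move->.
- exact/Forb_C3.
- exact noC5.
have tf : triangle_free by apply/Forb_C3; apply: chG; constructor 2.
by split=> //; [apply/Forb_C5 | apply/Forb_two_K2]; try exact: tf;
  apply: chG; [constructor 3 | constructor 1].
Qed.

End ChainGraph.

(** * Invariants of the generalized spectrum and the conclusion *)

Lemma mxtrace_adjacency_exp_cospectral (G H : sgraph) k : cospectral G H ->
  \tr (adjacency_matrix G ^+ k) = \tr (adjacency_matrix H ^+ k).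
Proof. by move=> cosGH; rewrite !mxtrace_adjacency_exp; apply: perm_big. Qed.

(** The trace formulas for [J - A] are triangular: the exponents 2, 3 and 4 determine in turn the
    entry sums of [A], [A ^+ 2] and [A ^+ 3], whose coefficients 2, 3 and 4 are cancelled up to
    sign. *)
Lemma entry_sum_adjacency_exp_cospectral (G H : sgraph) :
  generalized_cospectral G H ->
  [/\ entry_sum (adjacency_matrix G ^+ 1) = entry_sum (adjacency_matrix H ^+ 1)
    & entry_sum (adjacency_matrix G ^+ 3) = entry_sum (adjacency_matrix H ^+ 3)].
Proof.
move=> [cosGH cosGHc].
have eqt k := mxtrace_adjacency_exp_cospectral k cosGH.
have eqn : #|G|%:R = #|H|%:R :> algC by rewrite -!mxtrace1 -(eqt 0).
have eqc k : \tr ((const_mx 1 - adjacency_matrix G) ^+ k) =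
    \tr ((const_mx 1 - adjacency_matrix H) ^+ k).
  (* The binomial expansion reduces the claim to traces of powers of the complement's adjacency
     matrix. *)
  rewrite -!adjacency_matrix_compl !exprD1n !raddf_sum.
  apply: eq_bigr => i _; rewrite /= !raddfMn; congr (_ *+ _).
  exact: (mxtrace_adjacency_exp_cospectral i cosGHc).
have eq1 : entry_sum (adjacency_matrix G ^+ 1) = entry_sum (adjacency_matrix H ^+ 1).
  apply: (@mulfI _ 2); first by rewrite pnatr_eq0.
  have := eqc 2; rewrite !mxtrace_allonesB2 (eqt 2) eqn.
  by move=> /addIr/addrI/oppr_inj.
have eq2 : entry_sum (adjacency_matrix G ^+ 2) = entry_sum (adjacency_matrix H ^+ 2).
  apply: (@mulfI _ 3); first by rewrite pnatr_eq0.
  have := eqc 3; rewrite !mxtrace_allonesB3 (eqt 3) eqn eq1.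
  by move=> /addIr/addrI.
split=> //; apply: (@mulfI _ 4); first by rewrite pnatr_eq0.
have := eqc 4; rewrite !mxtrace_allonesB4 (eqt 4) eqn eq1 eq2.
by move=> /addIr/addrI/oppr_inj.
Qed.

(** The expression is a sum over quadruples of the 0/1 indicators [F] of an induced 2K2, so it
    vanishes exactly when every indicator does. *)
Lemma two_K2_freeP (G : sgraph) (A := adjacency_matrix G) : triangle_free G ->
  two_K2_free G <->
  entry_sum (A ^+ 1) ^+ 2 - 4%:R * entry_sum (A ^+ 3) + 2%:R * \tr (A ^+ 4) = 0.
Proof.
move=> tf; rewrite -sum_induced_2K2; last 2 first.
- by move=> i j; rewrite !mxE adj_sym.
- move=> i j k; have := tf [:: enum_val i; enum_val j; enum_val k] erefl.
  rewrite /= !mxE andbT (adj_sym _ (enum_val i)) -!natrM !mulnb.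
  by case: adj; case: adj; case: adj.
pose F i j k l := A i j * A k l *
  ((1 - A i k) * (1 - A i l) * (1 - A j k) * (1 - A j l)).
have FE i j k l (a := enum_val i) (b := enum_val j)
    (c := enum_val k) (d := enum_val l) :
  F i j k l = [&& adj a b, adj c d, ~~ adj a c, ~~ adj a d,
                  ~~ adj b c & ~~ adj b d]%:R.
  rewrite /F /A !mxE -/a -/b -/c -/d.
  by do 6!case: adj; rewrite /= ?(subrr, subr0, mulr0, mul0r, mulr1).
have F_ge0 i j k l : 0 <= F i j k l by rewrite FE ler0n.
split=> [free|sum0 a b c d].
  do 4!(apply: big1 => ? _); rewrite -/(F _ _ _ _) FE.
  by rewrite (negbTE (free _ _ _ _)).
have ge3 i j k : 0 <= \sum_l F i j k l by apply: sumr_ge0.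
have ge2 i j : 0 <= \sum_k \sum_l F i j k l by apply: sumr_ge0.
have ge1 i : 0 <= \sum_j \sum_k \sum_l F i j k l by apply: sumr_ge0.
have /(_ (enum_rank a) isT) := psumr_eq0P (fun i _ => ge1 i) sum0.
move/(psumr_eq0P (fun j _ => ge2 _ j))/(_ (enum_rank b) isT).
move/(psumr_eq0P (fun k _ => ge3 _ _ k))/(_ (enum_rank c) isT).
move/(psumr_eq0P (fun l _ => F_ge0 _ _ _ l))/(_ (enum_rank d) isT).
by move/eqP; rewrite FE !enum_rankK pnatr_eq0 eqb0.
Qed.

Theorem theorem1p3 : generalized_spectrally_closed chain_graph.
Proof.
move=> G H /chain_graphP[tfG noC5G no2K2G] cosGH.
have eqt k := mxtrace_adjacency_exp_cospectral k cosGH.1.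
(* This comes first because the counting formula for 2K2 in [H] presupposes it. *)
have tfH : triangle_free H.
  by apply/mxtrace_adjacency_exp_eq0; rewrite -eqt; apply/mxtrace_adjacency_exp_eq0.
apply/chain_graphP; split=> //.
  by apply/mxtrace_adjacency_exp_eq0; rewrite -eqt; apply/mxtrace_adjacency_exp_eq0.
have [eq1 eq3] := entry_sum_adjacency_exp_cospectral cosGH.
by apply/(two_K2_freeP tfH); rewrite -eqt -eq1 -eq3; apply/two_K2_freeP.
Qed.
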